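(* Let $a>0$ be fixed and, for $n>0$, let $L(n)$ be the arc length of the supercircle with scale parameter $a$ and shape parameter $n$. Then $L(n)$ attains its minimum over all $n>0$ at $n=1$, i.e. $L(n)\ge L(1)$ for all $n>0$, and $$L(1)=4\sqrt2\,a.$$
   Context: For real $a>0$, $n>0$, the supercircle with scale parameter $a$ and shape parameter $n$ is the closed plane curve given in polar coordinates by $r(\theta)=a\left(|\cos\theta|^n+|\sin\theta|^n\right)^{-1/n}$, $\theta\in[0,2\pi]$. Its arc length is the total length of this closed curve. *)

(* Defs.v *)
From HB Require Import structures.
From mathcomp Require Import all_boot all_order all_algebra.
From mathcomp Require Import all_classical all_reals all_analysis.

Set Implicit Arguments.
Unset Strict Implicit.
Unset Printing Implicit Defensive.

Import Order.TTheory GRing.Theory Num.Theory.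
Local Open Scope classical_set_scope.
Local Open Scope ring_scope.

(* The norm the library puts on the product R * R is the max norm, hence an
   explicit Euclidean distance. *)
Definition edist (R : realType) (p q : R * R) : R :=
  Num.sqrt ((p.1 - q.1) ^+ 2 + (p.2 - q.2) ^+ 2).

(* Length of the polygonal line through c u, c s_0, c s_1, ..., for a
   subdivision u < s_0 < s_1 < ... = v; same indexing as [variation]. *)
Definition polygonal_length (R : realType) (u v : R) (c : R -> R * R)
    (s : seq R) : R :=
  let F := c \o nth v (u :: s) in
  \sum_(0 <= k < size s) edist (F k.+1) (F k).

(* Supremum over all inscribed polygonal lines, the planar analogue of
   [total_variation]; it is +oo when the curve is not rectifiable. *)
Definition arc_length (R : realType) (u v : R) (c : R -> R * R) : \bar R :=
  ereal_sup [set (polygonal_length u v c s)%:E | s in itv_partition u v].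

Definition polar_curve (R : realType) (r : R -> R) (theta : R) : R * R :=
  (r theta * cos theta, r theta * sin theta).

Definition supercircle_radius (R : realType) (a n theta : R) : R :=
  a * (`|cos theta| `^ n + `|sin theta| `^ n) `^ (- n^-1).

Definition supercircle_length (R : realType) (a n : R) : \bar R :=
  arc_length 0 (2 * pi) (polar_curve (supercircle_radius a n)).

(* Main.v *)
(** At the angles [k * pi / 2] every supercircle passes through the vertices
    (a, 0), (0, a), (-a, 0), (0, -a), so the inscribed square already gives
    length at least [4 * sqrt 2 * a].  For [n = 1] the curve lies on the square
    [|x| + |y| = a]; there every chord between two angles is at most [sqrt 2]
    times the total variation of the abscissa, which is monotone on each half
    turn and varies by [2 * a] on each. *)
Require Import Defs.
From HB Require Import structures.
From mathcomp Require Import all_boot all_order all_algebra.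
From mathcomp Require Import all_classical all_reals all_analysis.
From mathcomp Require Import ring lra.

Import Order.TTheory GRing.Theory Num.Theory.
Local Open Scope ring_scope.

(** Over any subdivision the increments of [G] telescope, so a bound on single chords controls all
    inscribed polygons at once. *)
Lemma arc_length_le (R : realType) (u v : R) (c : R -> R * R) (G : R -> R) :
  (forall x y, u <= x -> x <= y -> y <= v -> Defs.edist (c y) (c x) <= G y - G x) ->
  (arc_length u v c <= (G v - G u)%:E)%E.
Proof.
move=> cG; apply: ge_ereal_sup => _ [s us <-]; rewrite lee_fin.
rewrite /polygonal_length.
have -> : G v - G u
    = \sum_(0 <= k < size s) (G (nth v (u :: s) k.+1) - G (nth v (u :: s) k)).
  by rewrite telescope_sumr//= (itv_partition_nth_size v us).
apply: ler_sum_nat => k /andP[_ ks] /=; apply: cG.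
- by apply: itv_partition_nth_ge us; exact: ltnW.
- by case: us => /(pathP v)/(_ k ks)/ltW.
- exact: (@itv_partition_nth_le _ _ _ _ _ k.+1 _ us).
Qed.

Lemma edist_le_sqrt2 (R : realType) (p q : R * R) (D : R) : 0 <= D ->
  (p.1 - q.1) ^+ 2 + (p.2 - q.2) ^+ 2 <= 2 * D ^+ 2 ->
  Defs.edist p q <= Num.sqrt 2 * D.
Proof.
move=> D0 h; rewrite -[D in leRHS]ger0_norm// -sqrtr_sqr -sqrtrM//.
by rewrite /Defs.edist ler_wsqrtr.
Qed.

Lemma supercircle_length_ge (R : realType) (a n : R) : 0 < a -> 0 < n ->
  ((4 * Num.sqrt 2 * a)%:E <= supercircle_length a n)%E.
Proof.
move=> a0 n0; have p0 := pi_gt0 R.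
apply: ereal_sup_ubound.
(* The starting angle [0] is implicit in a subdivision, so these four entries give the four sides of
   the square. *)
exists [:: pi / 2; pi; pi + pi / 2; 2 * pi].
  split; last by rewrite /=.
  by rewrite /= !andbT; apply/and4P; split; lra.
congr EFin; rewrite /polygonal_length /= big_nat_recl// big_nat_recl//.
rewrite big_nat_recl// big_nat1 /= /Defs.edist /polar_curve /supercircle_radius /=.
have cos2 : cos (2 * pi) = 1 :> R by rewrite mulr_natl cos2pi.
have sin2 : sin (2 * pi) = 0 :> R by rewrite mulr_natl sin2pi.
have cos3 : cos (pi + pi / 2) = 0 :> R by rewrite cosDpihalf sinpi oppr0.
have sin3 : sin (pi + pi / 2) = -1 :> R by rewrite sinDpihalf cospi.
rewrite cos2 sin2 cos3 sin3 cospi sinpi cos_pihalf sin_pihalf cos0 sin0.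
(* Here [n0] matters: the vanishing coordinate contributes [0] only because the exponent is nonzero.
   Each radius is then [a]. *)
rewrite !(normrN, normr0, normr1) powR0 ?gt_eqF// !(addr0, add0r) !powR1.
rewrite !(mulr1, mulr0, mulrN, subr0, sub0r, sqrrN, opprK) -mulr2n.
rewrite -[a ^+ 2 *+ 2]mulr_natl sqrtrM// sqrtr_sqr gtr0_norm//; ring.
Qed.

Section ShapeOne.
Context {R : realType} (a : R).
Hypothesis a_gt0 : 0 < a.
Implicit Types t u : R.

Let c t := polar_curve (supercircle_radius a 1) t.

Lemma norm_cos_sin_gt0 t : 0 < `|cos t| + `|sin t|.
Proof.
rewrite lt_neqAle addr_ge0// andbT eq_sym paddr_eq0// !normr_eq0.
apply/negP => /andP[/eqP c0 /eqP s0].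
by have := cos2Dsin2 t; rewrite c0 s0; lra.
Qed.

Lemma supercircle_radius1 t :
  supercircle_radius a 1 t = a / (`|cos t| + `|sin t|).
Proof. by rewrite /supercircle_radius !powRr1// invr1 powR_inv1// addr_ge0. Qed.

Lemma supercircle1_norm t : `|(c t).1| + `|(c t).2| = a.
Proof.
have s0 := norm_cos_sin_gt0 t.
rewrite /c /polar_curve /= supercircle_radius1 !normrM normfV.
by rewrite (gtr0_norm a_gt0) (gtr0_norm s0) -mulrDr mulfVK// gt_eqF.
Qed.

(** This central symmetry carries facts about the upper half turn over to the lower one. *)
Lemma supercircle1Dpi t : c (t + pi) = (- (c t).1, - (c t).2).
Proof.
by rewrite /c /polar_curve /= !supercircle_radius1 cosDpi sinDpi !normrN !mulrN.
Qed.

Lemma supercircle1_ordinate_ge0 t : 0 <= t -> t <= pi -> 0 <= (c t).2.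
Proof.
move=> t0 tp; rewrite /c /polar_curve /= supercircle_radius1.
by rewrite mulr_ge0 ?sin_ge0_pi ?t0// divr_ge0 ?ltW// norm_cos_sin_gt0.
Qed.

Lemma supercircle1_abscissa_nonincreasing t u : 0 <= t -> t <= u -> u <= pi ->
  (c u).1 <= (c t).1.
Proof.
move=> t0 tu up; have u_ge0 := le_trans t0 tu; have t_pi := le_trans tu up.
rewrite /c /polar_curve /= !supercircle_radius1.
have st0 := norm_cos_sin_gt0 t; have su0 := norm_cos_sin_gt0 u.
rewrite -!mulrA ler_pM2l// ![_^-1 * _]mulrC ler_pdivrMr// mulrAC ler_pdivlMr//.
have st : 0 <= sin t by rewrite sin_ge0_pi// t0 t_pi.
have su : 0 <= sin u by rewrite sin_ge0_pi// u_ge0.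
have cut : cos u <= cos t.
  move: tu; rewrite !leNgt; apply: contra.
  by rewrite ltr_cos// in_itv/= ?t0 ?u_ge0.
rewrite (ger0_norm st) (ger0_norm su).
(* After cross-multiplication the sine terms are exactly the expansion of [sin (u - t)]. The
   remaining cosine terms are settled by signs, [cut] excluding [cos t < 0 <= cos u]. *)
have : 0 <= sin (u - t) by rewrite sin_ge0_pi//; lra.
rewrite sinB => sut.
suff : cos u * `|cos t| <= cos t * `|cos u| by lra.
by case: (ger0P (cos t)) => ?; case: (ger0P (cos u)) => ?; nra.
Qed.

(* The variation of the abscissa on [0, t], for [0 <= t <= 2 * pi]. *)
Let abscissa_variation t :=
  if t <= pi then a - (c t).1 else 3 * a + (c t).1.

Lemma supercircle1_chord t u : 0 <= t -> t <= u -> u <= 2 * pi ->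
  Defs.edist (c u) (c t) <= Num.sqrt 2 * (abscissa_variation u - abscissa_variation t).
Proof.
move=> t0 tu u2; rewrite /abscissa_variation.
have nt := supercircle1_norm t; have nu := supercircle1_norm u.
have shift v : c v = (- (c (v - pi)).1, - (c (v - pi)).2).
  by rewrite -supercircle1Dpi subrK.
have lower v : pi < v -> v <= 2 * pi -> (c v).2 <= 0.
  move=> pv v2; rewrite shift /= oppr_le0.
  by apply: supercircle1_ordinate_ge0; lra.
have sqr_le (x y : R) : `|y| <= `|x| -> y ^+ 2 <= x ^+ 2.
  move=> yx; rewrite -[y ^+ 2]real_normK ?num_real//.
  by rewrite -[x ^+ 2]real_normK ?num_real// ler_sqr ?nnegrE.
have [up|pu] := leP u pi.
  have tp := le_trans tu up; rewrite tp.
  have xx := supercircle1_abscissa_nonincreasing _ _ t0 tu up.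
  have yu := supercircle1_ordinate_ge0 _ (le_trans t0 tu) up.
  have yt := supercircle1_ordinate_ge0 _ t0 tp.
  rewrite (ger0_norm yu) in nu; rewrite (ger0_norm yt) in nt.
  apply: edist_le_sqrt2; first lra.
  (* On the upper half the ordinate is [a] minus the absolute value of the abscissa, so the reverse
     triangle inequality applies. *)
  suff : ((c u).2 - (c t).2) ^+ 2 <= ((c u).1 - (c t).1) ^+ 2 by lra.
  apply: sqr_le; have := lerB_dist (c u).1 (c t).1.
  have := lerB_dist (c t).1 (c u).1; rewrite (distrC (c t).1) => h1 h2.
  by rewrite ler_norml; lra.
have yu := lower _ pu u2; rewrite (ler0_norm yu) in nu.
have [tp|pt] := leP t pi.
  have yt := supercircle1_ordinate_ge0 _ t0 tp.
  rewrite (ger0_norm yt) in nt.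
  have := ler_norm (c u).1; have := ler_norm (c t).1.
  have := ler_norm (- (c u).1); have := ler_norm (- (c t).1).
  rewrite !normrN => h1 h2 h3 h4.
  apply: edist_le_sqrt2; first lra.
  (* The chord straddles the angle [pi], and the variation is [D = 2 * a + (c u).1 + (c t).1]. Each
     squared coordinate difference is at most [D ^+ 2]. *)
  have : ((c u).2 - (c t).2) ^+ 2 <= (2 * a + (c u).1 + (c t).1) ^+ 2 => [|H].
    by apply: sqr_le; rewrite ler0_norm ?ger0_norm; lra.
  (* Four times this product is [D ^+ 2 - ((c u).1 - (c t).1) ^+ 2]. *)
  have : 0 <= (a + (c u).1) * (a + (c t).1) by apply: mulr_ge0; lra.
  by move: (c u) (c t) H => ? ? ?; nra.
(* Both points are on the lower half, where the symmetry makes the abscissa nondecreasing. *)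
have xx : (c t).1 <= (c u).1.
  rewrite (shift t) (shift u) /= lerN2.
  by apply: supercircle1_abscissa_nonincreasing; lra.
have yt := lower _ pt (le_trans tu u2); rewrite (ler0_norm yt) in nt.
apply: edist_le_sqrt2; first lra.
suff : ((c u).2 - (c t).2) ^+ 2 <= ((c u).1 - (c t).1) ^+ 2 by lra.
apply: sqr_le; have := lerB_dist (c u).1 (c t).1.
have := lerB_dist (c t).1 (c u).1; rewrite (distrC (c t).1) => h1 h2.
by rewrite ler_norml; lra.
Qed.

Lemma supercircle1_length_le :
  (supercircle_length a 1 <= (4 * Num.sqrt 2 * a)%:E)%E.
Proof.
pose G t := Num.sqrt 2 * abscissa_variation t.
(* The abscissa is [a] at both ends, so the variation runs from [a - a = 0] to
   [3 * a + a = 4 * a]. *)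
have -> : 4 * Num.sqrt 2 * a = G (2 * pi) - G 0.
  have p0 := pi_gt0 R; rewrite /G /abscissa_variation (ltW p0).
  have -> : (2 * pi <= pi :> R) = false by lra.
  rewrite /c /polar_curve /= !supercircle_radius1 [2 * pi]mulr_natl.
  by rewrite cos2pi sin2pi cos0 sin0 normr0 normr1 addr0 divr1; ring.
apply: arc_length_le => t u t0 tu u2; rewrite -mulrBr.
exact: supercircle1_chord.
Qed.

End ShapeOne.

Theorem corollary3p5 (R : realType) (a : R) (ha : 0 < a) :
  (forall n : R, 0 < n ->
     (supercircle_length a 1 <= supercircle_length a n)%E) /\
  supercircle_length a 1 = (4 * Num.sqrt 2 * a)%:E.
Proof.
have le1 := supercircle1_length_le a ha; split => [n n0|].
  exact: le_trans le1 (supercircle_length_ge _ _ _ ha n0).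
by apply/eqP; rewrite eq_le le1 supercircle_length_ge.
Qed.
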